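(* (Hölder inequality) Let $p_1,\dots,p_n\in(1,\infty)$ with $\sum_{k=1}^np_k^{-1}=1$, and let $A$ be a weighted geometric mean closed Archimedean $\Phi$-algebra over $\mathbb{K}$. (1) If $B$ is also a weighted geometric mean closed Archimedean $\Phi$-algebra over $\mathbb{K}$ and $T\colon A\to B$ is a positive linear map, then for all $a_1,\dots,a_n\in A$: $T\bigl(\prod_{k=1}^n|a_k|\bigr)\le\prod_{k=1}^n\bigl(T(|a_k|^{p_k})\bigr)^{1/p_k}$. (2) If $B$ is a weighted geometric mean closed Archimedean vector lattice over $\mathbb{K}$ and $T\colon A\to B$ is a positive linear map, then for all $a_1,\dots,a_n\in A$: $T\bigl(\prod_{k=1}^n|a_k|\bigr)\le\triangle_{k=1}^n\bigl(T(|a_k|^{p_k}),1/p_k\bigr)$.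
   Context: $\mathbb{K}$ denotes $\mathbb{R}$ or $\mathbb{C}$. An Archimedean vector lattice over $\mathbb{C}$ is $E+iE$ where $E$ is an Archimedean real vector lattice in which $\sup\{(\cos\theta)f+(\sin\theta)g:\theta\in[0,2\pi]\}$ exists for all $f,g$, with modulus $|f+ig|$ equal to that supremum; over $\mathbb{R}$ it is an Archimedean real vector lattice with $|f|=f\vee(-f)$. $E^+=\{f:|f|=f\}$, $E_\rho=E^+-E^+$ with its real lattice order. $E$ is weighted geometric mean closed if for all $f_1,\dots,f_n\in E$, $r_k\in(0,1)$ with $\sum r_k=1$, $\triangle_{k=1}^n(f_k,r_k):=\inf\{\sum_{k=1}^n r_k\theta_k|f_k|:\theta_k\in(0,\infty),\ \prod_k\theta_k^{r_k}=1\}$ exists in $E$. An Archimedean $\Phi$-algebra over $\mathbb{K}$: $A_\rho$ is an $f$-algebra with multiplicative identity $e$ (multiplication extended complex-bilinearly in the complex case). For $a\in A^+$ and $r\in(0,\infty)$, with $\lfloor r\rfloor=\max\{n\in\mathbb{N}\cup\{0\}:n\le r\}$ and $\tilde r=r-\lfloor r\rfloor$, $a^r=a^{\lfloor r\rfloor}\inf\{\tilde r\theta_1a+(1-\tilde r)\theta_2e:\theta_1,\theta_2>0,\ \theta_1^{\tilde r}\theta_2^{1-\tilde r}=1\}$, with $a^0=e$ and the infimum taken to be $e$ when $\tilde r=0$. A linear map $T$ is positive if $T(A^+)\subseteq B^+$. *)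

(* Defs.v *)
From Stdlib Require Import Reals ZArith ClassicalEpsilon.
Open Scope R_scope.

Record RVL := {
  vcar :> Type;
  vzero : vcar;
  vadd : vcar -> vcar -> vcar;
  vopp : vcar -> vcar;
  vscal : R -> vcar -> vcar;
  vle : vcar -> vcar -> Prop;
  vjoin : vcar -> vcar -> vcar;
  vmeet : vcar -> vcar -> vcar;
  vaddA : forall x y z, vadd x (vadd y z) = vadd (vadd x y) z;
  vaddC : forall x y, vadd x y = vadd y x;
  vadd0 : forall x, vadd vzero x = x;
  vaddN : forall x, vadd x (vopp x) = vzero;
  vscal1 : forall x, vscal 1 x = x;
  vscalA : forall a b x, vscal a (vscal b x) = vscal (a * b) x;
  vscalDr : forall a x y, vscal a (vadd x y) = vadd (vscal a x) (vscal a y);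
  vscalDl : forall a b x, vscal (a + b) x = vadd (vscal a x) (vscal b x);
  vle_refl : forall x, vle x x;
  vle_trans : forall x y z, vle x y -> vle y z -> vle x z;
  vle_anti : forall x y, vle x y -> vle y x -> x = y;
  vle_add : forall x y z, vle x y -> vle (vadd x z) (vadd y z);
  vle_scal : forall a x y, 0 <= a -> vle x y -> vle (vscal a x) (vscal a y);
  vjoin_l : forall x y, vle x (vjoin x y);
  vjoin_r : forall x y, vle y (vjoin x y);
  vjoin_lub : forall x y z, vle x z -> vle y z -> vle (vjoin x y) z;
  vmeet_l : forall x y, vle (vmeet x y) x;
  vmeet_r : forall x y, vle (vmeet x y) y;
  vmeet_glb : forall x y z, vle z x -> vle z y -> vle z (vmeet x y);
  varchi : forall x y, vle vzero x ->
     (forall n : nat, vle (vscal (INR n) x) y) -> x = vzero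
}.

Arguments vzero {_}. Arguments vadd {_}. Arguments vopp {_}. Arguments vscal {_}.
Arguments vle {_}. Arguments vjoin {_}. Arguments vmeet {_}.

Definition vsub {E : RVL} (x y : E) : E := vadd x (vopp y).

Definition vis_sup (E : RVL) (S : E -> Prop) (s : E) : Prop :=
  (forall x, S x -> vle x s) /\ (forall u, (forall x, S x -> vle x u) -> vle s u).
Definition vis_inf (E : RVL) (S : E -> Prop) (s : E) : Prop :=
  (forall x, S x -> vle s x) /\ (forall u, (forall x, S x -> vle u x) -> vle u s).
(* the supremum / infimum (meaningful when it exists) *)
Definition vSup (E : RVL) (S : E -> Prop) : E :=
  epsilon (inhabits (@vzero E)) (vis_sup E S).
Definition vInf (E : RVL) (S : E -> Prop) : E :=
  epsilon (inhabits (@vzero E)) (vis_inf E S).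

Fixpoint vsum {E : RVL} (n : nat) (f : nat -> E) : E :=
  match n with O => vzero | S m => vadd (vsum m f) (f m) end.
Fixpoint rsum (n : nat) (f : nat -> R) : R :=
  match n with O => 0 | S m => rsum m f + f m end.
Fixpoint rprod (n : nat) (f : nat -> R) : R :=
  match n with O => 1 | S m => rprod m f * f m end.

(* Archimedean Phi-algebras (real part): f-algebras with identity      *)
Record PhiAlg := {
  pa_vl :> RVL;
  pmul : pa_vl -> pa_vl -> pa_vl;
  pone : pa_vl;
  pmulA : forall x y z, pmul x (pmul y z) = pmul (pmul x y) z;
  pmulDl : forall x y z, pmul (vadd x y) z = vadd (pmul x z) (pmul y z);
  pmulDr : forall x y z, pmul x (vadd y z) = vadd (pmul x y) (pmul x z);
  pmulZl : forall a x y, pmul (vscal a x) y = vscal a (pmul x y);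
  pmulZr : forall a x y, pmul x (vscal a y) = vscal a (pmul x y);
  pmul_pos : forall x y, vle vzero x -> vle vzero y -> vle vzero (pmul x y);
  pmul_f : forall a b c, vmeet a b = vzero -> vle vzero c ->
      vmeet (pmul c a) b = vzero /\ vmeet (pmul a c) b = vzero;
  pmul1l : forall x, pmul pone x = x;
  pmul1r : forall x, pmul x pone = x
}.
Arguments pmul {_}. Arguments pone {_}.

Fixpoint eprod {A : PhiAlg} (n : nat) (f : nat -> A) : A :=
  match n with O => pone | S m => pmul (eprod m f) (f m) end.
Definition npow {A : PhiAlg} (a : A) (m : nat) : A := eprod m (fun _ => a).

(* real powers a^r (a >= 0, r >= 0), as in the paper:
   a^r = a^{floor r} * inf{ r~ t1 a + (1-r~) t2 e : t1,t2>0, t1^{r~} t2^{1-r~} = 1 },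
   the infimum being e when r~ = 0. *)
Definition epow {A : PhiAlg} (a : A) (r : R) : A :=
  let fr := frac_part r in
  pmul (npow a (Z.to_nat (Int_part r)))
       (if Req_dec_T fr 0 then pone
        else vInf A (fun x => exists t1 t2, 0 < t1 /\ 0 < t2 /\
                Rpower t1 fr * Rpower t2 (1 - fr) = 1 /\
                x = vadd (vscal (fr * t1) a) (vscal ((1 - fr) * t2) pone))).

Inductive Kfield := KR | KC.

Definition Kscal (K : Kfield) : Type :=
  match K with KR => R | KC => (R * R)%type end.

(* the vector lattice over K built on the real lattice E: E itself, or E + iE *)
Definition Kcar (K : Kfield) (E : RVL) : Type :=
  match K with KR => vcar E | KC => (vcar E * vcar E)%type end.

(* condition on E for E + iE to be an (Archimedean) vector lattice over C *)
Definition csup_cond (E : RVL) : Prop :=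
  forall f g : E, exists s, vis_sup E
    (fun x => exists t, 0 <= t <= 2 * PI /\ x = vadd (vscal (cos t) f) (vscal (sin t) g)) s.
Definition Kcond (K : Kfield) (E : RVL) : Prop :=
  match K with KR => True | KC => csup_cond E end.

Definition Kadd (K : Kfield) (E : RVL) : Kcar K E -> Kcar K E -> Kcar K E :=
  match K as K0 return Kcar K0 E -> Kcar K0 E -> Kcar K0 E with
  | KR => fun x y => vadd x y
  | KC => fun x y => (vadd (fst x) (fst y), vadd (snd x) (snd y))
  end.
Definition Kopp (K : Kfield) (E : RVL) : Kcar K E -> Kcar K E :=
  match K as K0 return Kcar K0 E -> Kcar K0 E with
  | KR => fun x => vopp x
  | KC => fun x => (vopp (fst x), vopp (snd x))
  end.
Definition Kscale (K : Kfield) (E : RVL) : Kscal K -> Kcar K E -> Kcar K E :=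
  match K as K0 return Kscal K0 -> Kcar K0 E -> Kcar K0 E with
  | KR => fun a x => vscal a x
  | KC => fun c x => (vsub (vscal (fst c) (fst x)) (vscal (snd c) (snd x)),
                      vadd (vscal (fst c) (snd x)) (vscal (snd c) (fst x)))
  end.
Definition Kemb (K : Kfield) (E : RVL) : E -> Kcar K E :=
  match K as K0 return E -> Kcar K0 E with
  | KR => fun f => f
  | KC => fun f => (f, vzero)
  end.
Definition Kre (K : Kfield) (E : RVL) : Kcar K E -> E :=
  match K as K0 return Kcar K0 E -> E with
  | KR => fun f => f
  | KC => fun x => fst x
  end.
Definition Kmod (K : Kfield) (E : RVL) : Kcar K E -> E :=
  match K as K0 return Kcar K0 E -> E with
  | KR => fun f => vjoin f (vopp f)
  | KC => fun x => vSup E (fun y => exists t, 0 <= t <= 2 * PI /\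
              y = vadd (vscal (cos t) (fst x)) (vscal (sin t) (snd x)))
  end.

Definition Kpos (K : Kfield) (E : RVL) (u : Kcar K E) : Prop :=
  Kemb K E (Kmod K E u) = u.
Definition Kle (K : Kfield) (E : RVL) (u v : Kcar K E) : Prop :=
  Kpos K E (Kadd K E v (Kopp K E u)).

Definition Klinear (K : Kfield) (A B : RVL) (T : Kcar K A -> Kcar K B) : Prop :=
  (forall u v, T (Kadd K A u v) = Kadd K B (T u) (T v)) /\
  (forall c u, T (Kscale K A c u) = Kscale K B c (T u)).
Definition Kpositive (K : Kfield) (A B : RVL) (T : Kcar K A -> Kcar K B) : Prop :=
  forall u, Kpos K A u -> Kpos K B (T u).

Definition tri_set (K : Kfield) (E : RVL) (n : nat) (f : nat -> Kcar K E) (r : nat -> R)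
  : E -> Prop :=
  fun x => exists th : nat -> R, (forall k, (k < n)%nat -> 0 < th k) /\
     rprod n (fun k => Rpower (th k) (r k)) = 1 /\
     x = vsum n (fun k => vscal (r k * th k) (Kmod K E (f k))).
Definition tri (K : Kfield) (E : RVL) (n : nat) (f : nat -> Kcar K E) (r : nat -> R) : E :=
  vInf E (tri_set K E n f r).

Definition wgm_closed (K : Kfield) (E : RVL) : Prop :=
  forall (n : nat) (f : nat -> Kcar K E) (r : nat -> R),
    (forall k, (k < n)%nat -> 0 < r k < 1) -> rsum n r = 1 ->
    exists x, vis_inf E (tri_set K E n f r) x.

(* Main.v *)
Require Import Defs.
From Stdlib Require Import Reals ZArith ClassicalEpsilon Lra Lia Classical.
Open Scope R_scope.

(** Say that [g <= h] on the support of [v >= 0] when [g <= h + d] for some [d >= 0]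
    disjoint from [v]. This relation is compatible with sums, products and (by order
    continuity) infima, and [g <= h] holds as soon as every [v > 0] dominates some
    [v' > 0] on the support of which [g <= h]. Given [lam > 1] and finitely many
    [b_k >= 0], every [v > 0] dominates some [v' > 0] on the support of which either some
    [b_k] vanishes or each [b_k] is squeezed between scalars [s_k e] and [lam s_k e];
    there every inequality reduces, up to a factor tending to 1 with [lam], to one
    between real numbers. This yields Young's inequality
    [prod x_k <= sum (t_k / p_k) x_k^(p_k)] for [prod t_k^(1/p_k) = 1] in [A], to which
    [T] is applied, and, in [B], the inequality between the geometric mean of the [b_k]
    and [prod b_k^(1/p_k)], for which the weights [t_k = G / s_k] with
    [G = prod s_k^(1/p_k)] are used on each cell. *)

(** * Archimedean vector lattices *)

Section VectorLattice.
Context {E : RVL}.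
Implicit Types x y z u v w d g h : E.

Lemma vaddr0 x : vadd x vzero = x.
Proof. now rewrite vaddC, vadd0. Qed.

Lemma vaddNl x : vadd (vopp x) x = vzero.
Proof. now rewrite vaddC, vaddN. Qed.

Lemma vaddK x y : vsub (vadd x y) y = x.
Proof. unfold vsub. now rewrite <- vaddA, vaddN, vaddr0. Qed.

Lemma vsubK x y : vadd (vsub x y) y = x.
Proof. unfold vsub. now rewrite <- vaddA, vaddNl, vaddr0. Qed.

Lemma vadd_inj x y z : vadd x z = vadd y z -> x = y.
Proof. intros H. rewrite <- (vaddK x z), H. apply vaddK. Qed.

Lemma vaddACA x y z w : vadd (vadd x y) (vadd z w) = vadd (vadd x z) (vadd y w).
Proof. rewrite !vaddA. f_equal. rewrite <- !vaddA. f_equal. apply vaddC. Qed.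

Lemma vscal0l x : vscal 0 x = vzero.
Proof.
  apply (vadd_inj _ _ (vscal 0 x)).
  rewrite <- vscalDl, vadd0. f_equal. ring.
Qed.

Lemma vscal0r (a : R) : vscal a (vzero : E) = vzero.
Proof. rewrite <- (vscal0l vzero), vscalA. f_equal. ring. Qed.

Lemma vopp0 : vopp (vzero : E) = vzero.
Proof. now rewrite <- (vadd0 E (vopp vzero)), vaddN. Qed.

Lemma vscalN1 x : vscal (-1) x = vopp x.
Proof.
  apply (vadd_inj _ _ x). rewrite vaddNl.
  rewrite <- (vscal1 E x) at 2. rewrite <- vscalDl, <- (vscal0l x). f_equal. ring.
Qed.

Lemma vsubr0 x : vsub x vzero = x.
Proof. unfold vsub. now rewrite vopp0, vaddr0. Qed.

Lemma vle_addl x y z : vle y z -> vle (vadd x y) (vadd x z).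
Proof. intros H. rewrite !(vaddC E x). now apply vle_add. Qed.

Lemma vle_add2 x y z w : vle x y -> vle z w -> vle (vadd x z) (vadd y w).
Proof. intros H1 H2. eapply vle_trans; [apply vle_add, H1 | now apply vle_addl]. Qed.

Lemma vle_add_cancel x y z : vle (vadd x z) (vadd y z) -> vle x y.
Proof.
  intros H. rewrite <- (vaddK x z), <- (vaddK y z). now apply vle_add.
Qed.

Lemma vle_subLR x y z : vle (vsub x y) z <-> vle x (vadd z y).
Proof.
  split; intros H.
  - rewrite <- (vsubK x y). now apply vle_add.
  - apply (vle_add_cancel _ _ y). now rewrite vsubK.
Qed.

Lemma vle_subRL x y z : vle x (vsub y z) <-> vle (vadd x z) y.
Proof.
  split; intros H.
  - rewrite <- (vsubK y z). now apply vle_add.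
  - apply (vle_add_cancel _ _ z). now rewrite vsubK.
Qed.

Lemma vsub_ge0 x y : vle vzero (vsub y x) <-> vle x y.
Proof. now rewrite vle_subRL, vadd0. Qed.

Lemma vle_addr x y : vle vzero y -> vle x (vadd x y).
Proof. intros H. rewrite <- (vaddr0 x) at 1. now apply vle_addl. Qed.

Lemma vadd_ge0 x y : vle vzero x -> vle vzero y -> vle vzero (vadd x y).
Proof. intros H1 H2. rewrite <- (vadd0 E vzero). now apply vle_add2. Qed.

Lemma vscal_ge0 (a : R) x : 0 <= a -> vle vzero x -> vle vzero (vscal a x).
Proof. intros Ha H. rewrite <- (vscal0r a). now apply vle_scal. Qed.

Lemma vle_scal_le (a b : R) x : a <= b -> vle vzero x -> vle (vscal a x) (vscal b x).
Proof.
  intros H Hx. replace b with (a + (b - a)) by ring. rewrite vscalDl.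
  apply vle_addr, vscal_ge0; [lra | assumption].
Qed.

Lemma vle_opp_ge0 x : vle (vopp x) x -> vle vzero x.
Proof.
  intros H. replace x with (vscal (/ 2) (vadd x x)).
  - apply vscal_ge0; [lra|]. rewrite <- (vaddNl x). now apply vle_add.
  - rewrite vscalDr, <- vscalDl. replace (/ 2 + / 2) with 1 by field. apply vscal1.
Qed.

(** * Disjointness and positive parts *)

Lemma vmeetC x y : vmeet x y = vmeet y x.
Proof.
  apply vle_anti; apply vmeet_glb; (apply vmeet_l || apply vmeet_r).
Qed.

Lemma vmeet_ge0 x y : vle vzero x -> vle vzero y -> vle vzero (vmeet x y).
Proof. now apply vmeet_glb. Qed.

Lemma vmeet_eq0_le d d' v v' :
  vle vzero d' -> vle vzero v' -> vle d' d -> vle v' v ->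
  vmeet d v = vzero -> vmeet d' v' = vzero.
Proof.
  intros Hd Hv H1 H2 H. apply vle_anti; [|now apply vmeet_ge0].
  rewrite <- H. apply vmeet_glb; eapply vle_trans; eauto; (apply vmeet_l || apply vmeet_r).
Qed.

Lemma vmeet_eq0_le0 d v z : vmeet d v = vzero -> vle z d -> vle z v -> vle z vzero.
Proof. intros H H1 H2. rewrite <- H. now apply vmeet_glb. Qed.

(** Subtracting [d] from the meet leaves an element below both [d'] and [v], hence at most 0. So the
    meet itself lies below [d] and [v]. *)
Lemma vmeet_add_eq0 d d' v :
  vle vzero d -> vle vzero d' -> vle vzero v ->
  vmeet d v = vzero -> vmeet d' v = vzero -> vmeet (vadd d d') v = vzero.
Proof.
  intros Hd Hd' Hv H H'. apply vle_anti.
  2: { apply vmeet_ge0; [now apply vadd_ge0 | assumption]. }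
  apply (vmeet_eq0_le0 d v); auto; [|apply vmeet_r].
  rewrite <- (vadd0 E d) at 2. apply vle_subLR.
  apply (vmeet_eq0_le0 d' v); auto.
  - apply vle_subLR. rewrite vaddC. apply vmeet_l.
  - apply vle_subLR. eapply vle_trans; [apply vmeet_r|]. now apply vle_addr.
Qed.

(** When [d] is disjoint from [y] the right side is just [x]: an error term living off the support
    of [y] disappears under a meet with [y]. *)
Lemma vmeet_addl_le x d y :
  vle vzero x -> vle (vmeet (vadd x d) y) (vadd x (vmeet d y)).
Proof.
  intros Hx. rewrite (vaddC E x (vmeet d y)). apply vle_subLR, vmeet_glb; apply vle_subLR.
  - rewrite (vaddC E d x). apply vmeet_l.
  - eapply vle_trans; [apply vmeet_r | now apply vle_addr].
Qed.

Definition vpos x : E := vjoin x vzero.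

Lemma vpos_ge0 x : vle vzero (vpos x).
Proof. apply vjoin_r. Qed.

Lemma vpos_ge x : vle x (vpos x).
Proof. apply vjoin_l. Qed.

Lemma vpos_le x y : vle vzero y -> vle x y -> vle (vpos x) y.
Proof. intros. now apply vjoin_lub. Qed.

Lemma vpos_sub_ge x y : vle x (vadd y (vpos (vsub x y))).
Proof. rewrite vaddC. apply vle_subLR, vpos_ge. Qed.

(** Let [m] be the meet. Since [(y-x)^+ <= (x-y)^+ - (x-y)], the element [(x-y)^+ - m] still
    dominates [x-y] and 0, hence dominates [(x-y)^+], and [m <= 0]. *)
Lemma vpos_disjoint x y : vmeet (vpos (vsub x y)) (vpos (vsub y x)) = vzero.
Proof.
  set (m := vmeet _ _).
  assert (H1 : vle m (vpos (vsub x y))) by apply vmeet_l.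
  assert (H2 : vle m (vpos (vsub y x))) by apply vmeet_r.
  apply vle_anti; [|apply vmeet_ge0; apply vpos_ge0].
  apply (vle_add_cancel _ _ (vpos (vsub x y))). rewrite vadd0, vaddC.
  apply vle_subRL, vpos_le; apply vle_subRL.
  - now rewrite vadd0.
  - rewrite vaddC. apply vle_subRL. eapply vle_trans; [apply H2|]. apply vpos_le.
    + apply vsub_ge0, vpos_ge.
    + apply vle_subRL. eapply vle_trans; [|apply vpos_ge0].
      unfold vsub. rewrite (vaddC E x (vopp y)), vaddACA, vaddN, vaddNl, vadd0. apply vle_refl.
Qed.

(** * Inequalities on the support of a positive element *)

(** The relation [vle_on v g h] says that [g <= h] holds on the support of [v]. *)
Definition vle_on v g h : Prop :=
  exists d, vle vzero d /\ vmeet d v = vzero /\ vle g (vadd h d).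

Lemma vle_on_le v g h : vle vzero v -> vle g h -> vle_on v g h.
Proof.
  intros Hv H. exists vzero. repeat split; [apply vle_refl| |now rewrite vaddr0].
  apply vle_anti; [apply vmeet_l | apply vmeet_ge0; [apply vle_refl | assumption]].
Qed.

Lemma vle_on_trans v g h w : vle vzero v -> vle_on v g h -> vle_on v h w -> vle_on v g w.
Proof.
  intros Hv (d & Hd & Md & Ld) (d' & Hd' & Md' & Ld'). exists (vadd d' d).
  repeat split; [now apply vadd_ge0 | now apply vmeet_add_eq0 |].
  eapply vle_trans; [apply Ld|]. rewrite vaddA. now apply vle_add.
Qed.

Lemma vle_on_add v g h g' h' :
  vle vzero v -> vle_on v g h -> vle_on v g' h' -> vle_on v (vadd g g') (vadd h h').
Proof.
  intros Hv (d & Hd & Md & Ld) (d' & Hd' & Md' & Ld'). exists (vadd d d').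
  repeat split; [now apply vadd_ge0 | now apply vmeet_add_eq0 |].
  rewrite vaddACA. now apply vle_add2.
Qed.

Lemma vle_on_weaken v v' g h : vle vzero v' -> vle v' v -> vle_on v g h -> vle_on v' g h.
Proof.
  intros Hv' H (d & Hd & Md & Ld). exists d. repeat split; auto.
  apply (vmeet_eq0_le d d v v'); auto. apply vle_refl.
Qed.

(** Let [v'] be the meet of [v] with [(g-h)^+]. If it is zero, [(g-h)^+] is an admissible error
    term. Otherwise [v'] is disjoint from [(h-g)^+], which is then the error term for the reverse
    inequality. *)
Lemma vle_on_total v g h :
  vle vzero v ->
  vle_on v g h \/ exists v', vle vzero v' /\ v' <> vzero /\ vle v' v /\ vle_on v' h g.
Proof.
  intros Hv.
  set (v' := vmeet v (vpos (vsub g h))).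
  destruct (classic (v' = vzero)) as [H|H].
  - left. exists (vpos (vsub g h)). repeat split; [apply vpos_ge0 | now rewrite vmeetC |].
    apply vpos_sub_ge.
  - right. exists v'. repeat split; auto.
    + apply vmeet_ge0; [assumption | apply vpos_ge0].
    + apply vmeet_l.
    + exists (vpos (vsub h g)). repeat split; [apply vpos_ge0 | |apply vpos_sub_ge].
      apply (vmeet_eq0_le (vpos (vsub h g)) _ (vpos (vsub g h))).
      * apply vpos_ge0.
      * apply vmeet_ge0; [assumption | apply vpos_ge0].
      * apply vle_refl.
      * apply vmeet_r.
      * apply vpos_disjoint.
Qed.

(** Test with [v = (g-h)^+]: the [v'] obtained satisfies [v' <= v <= d] while being disjoint from
    [d], so it would be zero. *)
Lemma vle_local_global g h :
  (forall v, vle vzero v -> v <> vzero ->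
     exists v', vle vzero v' /\ v' <> vzero /\ vle v' v /\ vle_on v' g h) ->
  vle g h.
Proof.
  intros H. destruct (classic (vpos (vsub g h) = vzero)) as [E0|E0].
  - rewrite <- (vadd0 E h). apply vle_subLR. rewrite <- E0. apply vpos_ge.
  - destruct (H _ (vpos_ge0 _) E0) as (v' & Hv & Hn & Hle & d & Hd & Md & Ld).
    exfalso. apply Hn, vle_anti; [|assumption].
    apply (vmeet_eq0_le0 d v'); auto; [|apply vle_refl].
    eapply vle_trans; [apply Hle|]. apply vpos_le; [assumption|].
    apply vle_subLR. now rewrite vaddC.
Qed.

Lemma vle_on_archimedean v g h k :
  vle vzero v -> vle vzero k ->
  (forall n : nat, vle_on v g (vadd h (vscal (/ INR (S n)) k))) -> vle_on v g h.
Proof.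
  intros Hv Hk H. exists (vpos (vsub g h)).
  repeat split; [apply vpos_ge0 | | apply vpos_sub_ge].
  set (z := vmeet _ _).
  assert (Hz : vle vzero z) by (apply vmeet_ge0; [apply vpos_ge0 | assumption]).
  apply (varchi E z k Hz). intros [|n].
  { simpl INR. now rewrite vscal0l. }
  destruct (H n) as (d & Hd & Md & Ld).
  assert (Hn : 0 < INR (S n)) by apply lt_0_INR, Nat.lt_0_succ.
  assert (Hk' : vle vzero (vscal (/ INR (S n)) k)).
  { apply vscal_ge0; auto. now apply Rlt_le, Rinv_0_lt_compat. }
  (* The error [d] is disjoint from [v] and [z <= v], so only the term in [k] survives the meet. *)
  assert (Hzk : vle z (vscal (/ INR (S n)) k)).
  { rewrite <- (vaddr0 (vscal _ k)), <- Md.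
    eapply vle_trans; [|now apply vmeet_addl_le].
    apply vmeet_glb; [|apply vmeet_r]. eapply vle_trans; [apply vmeet_l|].
    apply vpos_le; [now apply vadd_ge0|]. apply vle_subLR.
    rewrite vaddC, vaddA. exact Ld. }
  apply (vle_scal E (INR (S n))) in Hzk; [|lra].
  rewrite vscalA, Rinv_r, vscal1 in Hzk by lra. exact Hzk.
Qed.

(** Absorbs the multiplicative loss made on each cell; the factors [1 + 1/(n+1)] suffice, by the
    Archimedean property. *)
Lemma vle_of_forall_scal_gt1 g h :
  vle vzero h -> (forall mu, 1 < mu -> vle g (vscal mu h)) -> vle g h.
Proof.
  intros Hh H. apply vle_local_global. intros v Hv Hn.
  exists v. repeat split; auto; [apply vle_refl|].
  apply (vle_on_archimedean v g h h); auto. intros n. apply vle_on_le; auto.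
  rewrite <- (vscal1 E h) at 1. rewrite <- vscalDl. apply H.
  assert (0 < / INR (S n)) by apply Rinv_0_lt_compat, lt_0_INR, Nat.lt_0_succ. lra.
Qed.

End VectorLattice.

(** * Finite sums *)

Lemma vsum_le {E : RVL} n (f g : nat -> E) :
  (forall k, (k < n)%nat -> vle (f k) (g k)) -> vle (vsum n f) (vsum n g).
Proof.
  induction n as [|n IH]; intros H; simpl; [apply vle_refl|].
  apply vle_add2; [apply IH; intros; apply H; lia | apply H; lia].
Qed.

Lemma vsum_ge0 {E : RVL} n (f : nat -> E) :
  (forall k, (k < n)%nat -> vle vzero (f k)) -> vle vzero (vsum n f).
Proof.
  induction n as [|n IH]; intros H; simpl; [apply vle_refl|].
  apply vadd_ge0; [apply IH; intros; apply H; lia | apply H; lia].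
Qed.

Lemma vsum_scall {E : RVL} n (r : nat -> R) (x : E) :
  vsum n (fun k => vscal (r k) x) = vscal (rsum n r) x.
Proof.
  induction n as [|n IH]; simpl; [now rewrite vscal0l|].
  now rewrite IH, vscalDl.
Qed.

Lemma vsum_scalr {E : RVL} n c (f : nat -> E) :
  vsum n (fun k => vscal c (f k)) = vscal c (vsum n f).
Proof.
  induction n as [|n IH]; simpl; [now rewrite vscal0r|].
  now rewrite IH, vscalDr.
Qed.

Lemma vsum_vle_on {E : RVL} (v : E) n (f g : nat -> E) :
  vle vzero v -> (forall k, (k < n)%nat -> vle_on v (f k) (g k)) ->
  vle_on v (vsum n f) (vsum n g).
Proof.
  intros Hv. induction n as [|n IH]; intros H; simpl; [apply vle_on_le; auto; apply vle_refl|].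
  apply vle_on_add; auto.
Qed.

(** * Weighted arithmetic-geometric mean inequality for real numbers *)

Lemma rsum_ext n f g : (forall k, (k < n)%nat -> f k = g k) -> rsum n f = rsum n g.
Proof.
  induction n as [|n IH]; intros H; simpl; [reflexivity|].
  rewrite IH by (intros; apply H; lia). now rewrite H by lia.
Qed.

Lemma rsum_le n f g : (forall k, (k < n)%nat -> f k <= g k) -> rsum n f <= rsum n g.
Proof.
  induction n as [|n IH]; intros H; simpl; [lra|].
  apply Rplus_le_compat; [apply IH; intros; apply H; lia | apply H; lia].
Qed.

Lemma rsum_add n f g : rsum n (fun k => f k + g k) = rsum n f + rsum n g.
Proof. induction n as [|n IH]; simpl; [lra | rewrite IH; ring]. Qed.

Lemma rsum_mulr n f c : rsum n (fun k => f k * c) = rsum n f * c.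
Proof. induction n as [|n IH]; simpl; [lra | rewrite IH; ring]. Qed.

Lemma rprod_ext n f g : (forall k, (k < n)%nat -> f k = g k) -> rprod n f = rprod n g.
Proof.
  induction n as [|n IH]; intros H; simpl; [reflexivity|].
  rewrite IH by (intros; apply H; lia). now rewrite H by lia.
Qed.

Lemma rprod_mul n f g : rprod n (fun k => f k * g k) = rprod n f * rprod n g.
Proof. induction n as [|n IH]; simpl; [lra | rewrite IH; ring]. Qed.

Lemma rprod_pos n f : (forall k, (k < n)%nat -> 0 < f k) -> 0 < rprod n f.
Proof.
  induction n as [|n IH]; intros H; simpl; [lra|].
  apply Rmult_lt_0_compat; [apply IH; intros; apply H; lia | apply H; lia].
Qed.

Lemma rprod_Rpower_exp n y r :
  rprod n (fun k => Rpower (y k) (r k)) = exp (rsum n (fun k => r k * ln (y k))).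
Proof.
  induction n as [|n IH]; simpl; [now rewrite exp_0|].
  rewrite exp_plus, IH. reflexivity.
Qed.

Lemma rprod_Rpower_const n c r :
  rprod n (fun k => Rpower c (r k)) = Rpower c (rsum n r).
Proof. rewrite rprod_Rpower_exp, rsum_mulr. reflexivity. Qed.

Lemma ln_le_sub1 x : 0 < x -> ln x <= x - 1.
Proof.
  intros Hx. pose proof (exp_ineq1_le (ln x)) as H. rewrite exp_ln in H by assumption. lra.
Qed.

(** With [exp L] the geometric mean, apply [ln q <= q - 1] to [q = y k / exp L] and average with the
    weights [r k]: the logarithms average to 0. *)
Lemma weighted_AMGM n y r :
  (forall k, (k < n)%nat -> 0 < y k) -> (forall k, (k < n)%nat -> 0 < r k) ->
  rsum n r = 1 ->
  rprod n (fun k => Rpower (y k) (r k)) <= rsum n (fun k => r k * y k).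
Proof.
  intros Hy Hr H1. rewrite rprod_Rpower_exp.
  set (L := rsum n (fun k => r k * ln (y k))).
  assert (HG : 0 < exp L) by apply exp_pos.
  assert (H : rsum n (fun k => r k * ln (y k) + r k * (1 - L))
              <= rsum n (fun k => r k * y k * / exp L)).
  { apply rsum_le. intros k Hk.
    assert (Hq : 0 < y k / exp L) by (apply Rdiv_lt_0_compat; auto).
    apply ln_le_sub1 in Hq. unfold Rdiv in Hq.
    rewrite ln_mult, ln_Rinv, ln_exp in Hq by (auto using Rinv_0_lt_compat).
    rewrite <- Rmult_plus_distr_l, Rmult_assoc.
    apply Rmult_le_compat_l; [apply Rlt_le; auto | lra]. }
  rewrite rsum_add, !rsum_mulr, H1 in H. fold L in H.
  apply (Rmult_le_compat_r (exp L)) in H; [|lra].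
  rewrite Rmult_assoc, Rinv_l in H by lra. lra.
Qed.

Lemma Rpower_base_mult x y r : 0 < x -> 0 < y -> Rpower (x * y) r = Rpower x r * Rpower y r.
Proof. intros. symmetry. now apply Rpower_mult_distr. Qed.

(** Arithmetic-geometric means for [t k * s k ^ p k] with weights [/ p k]; the factors [t k] drop
    out of the geometric mean by their normalisation. *)
Lemma young_real n p t s :
  (forall k, (k < n)%nat -> 1 < p k) -> rsum n (fun k => / p k) = 1 ->
  (forall k, (k < n)%nat -> 0 < t k) -> (forall k, (k < n)%nat -> 0 < s k) ->
  rprod n (fun k => Rpower (t k) (/ p k)) = 1 ->
  rprod n s <= rsum n (fun k => / p k * t k * Rpower (s k) (p k)).
Proof.
  intros Hp H1 Ht Hs Hprod.
  pose proof (weighted_AMGM n (fun k => t k * Rpower (s k) (p k)) (fun k => / p k)) as H.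
  eapply Rle_trans; [|eapply Rle_trans; [apply H|]]; auto.
  - right.
    transitivity (rprod n (fun k => Rpower (t k) (/ p k)) * rprod n s).
    { rewrite Hprod. ring. }
    rewrite <- rprod_mul. apply rprod_ext. intros k Hk.
    specialize (Hp k Hk). specialize (Hs k Hk). specialize (Ht k Hk).
    rewrite Rpower_base_mult by (auto; apply exp_pos).
    rewrite Rpower_mult, Rinv_r, Rpower_1; auto. lra.
  - intros k Hk. apply Rmult_lt_0_compat; [auto | apply exp_pos].
  - intros k Hk. apply Rinv_0_lt_compat. specialize (Hp k Hk). lra.
  - right. apply rsum_ext. intros. ring.
Qed.

Lemma geometric_unbounded lam eta M : 1 < lam -> 0 < eta -> exists N, M <= eta * lam ^ N.
Proof.
  intros Hl He.
  destruct (Pow_x_infinity lam (ltac:(rewrite Rabs_pos_eq; lra)) (Rabs M / eta)) as [N HN].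
  exists N. specialize (HN N (Nat.le_refl N)).
  rewrite Rabs_pos_eq in HN by (apply pow_le; lra).
  apply Rge_le, (Rmult_le_compat_l eta) in HN; [|lra].
  replace (eta * (Rabs M / eta)) with (Rabs M) in HN by (field; lra).
  pose proof (Rle_abs M). lra.
Qed.

(** * Unital f-algebras *)

Section PhiAlgebra.
Context {A : PhiAlg}.
Implicit Types x y z u v w d g h b : A.

Lemma pmul0r x : pmul x vzero = vzero.
Proof. rewrite <- (vscal0l vzero), pmulZr. now rewrite !vscal0l. Qed.

Lemma pmul0l x : pmul vzero x = vzero.
Proof. rewrite <- (vscal0l vzero), pmulZl. now rewrite !vscal0l. Qed.

Lemma pmul_lel x y z : vle vzero x -> vle y z -> vle (pmul x y) (pmul x z).
Proof.
  intros Hx H. rewrite <- (vsubK z y), pmulDr, vaddC.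
  apply vle_addr, pmul_pos; [assumption | now apply vsub_ge0].
Qed.

Lemma pmul_ler x y z : vle vzero x -> vle y z -> vle (pmul y x) (pmul z x).
Proof.
  intros Hx H. rewrite <- (vsubK z y), pmulDl, vaddC.
  apply vle_addr, pmul_pos; [now apply vsub_ge0 | assumption].
Qed.

(* With [q] the negative part of [e] and [p] the positive one,
   [q = q e <= q p = 0]. *)
Lemma pone_ge0 : vle vzero (pone : A).
Proof.
  set (p := vpos (vsub pone vzero) : A). set (q := vpos (vsub vzero pone) : A).
  assert (Hp : vle vzero p) by apply vpos_ge0.
  assert (Hq : vle vzero q) by apply vpos_ge0.
  assert (D : vmeet p q = vzero) by apply vpos_disjoint.
  destruct (pmul_f A p q q D Hq) as [D1 _]. rewrite vmeetC in D1.
  destruct (pmul_f A q (pmul q p) p D1 Hp) as [_ D2].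
  rewrite <- (vaddr0 pone), <- (vadd0 A (vadd pone vzero)). apply vle_subLR.
  eapply vle_trans; [apply vpos_ge|]. fold q. rewrite vaddr0.
  assert (H : vle q (pmul q p)).
  { rewrite <- (pmul1r A q) at 1. apply pmul_lel; [assumption|].
    rewrite <- (vsubr0 pone). apply vpos_ge. }
  now apply (vmeet_eq0_le0 _ _ q D2).
Qed.

Lemma vscal_pmul c x : vscal c x = pmul (vscal c pone) x.
Proof. now rewrite pmulZl, pmul1l. Qed.

Lemma vscal_pone_ge0 c : 0 <= c -> vle vzero (vscal c pone : A).
Proof. intros. apply vscal_ge0; auto using pone_ge0. Qed.

(** Scaling is multiplication by the positive element [c e], so this is an instance of the f-algebra
    axiom. *)
Lemma vmeet_scal_eq0 c d v : 0 <= c -> vmeet d v = vzero -> vmeet (vscal c d) v = vzero.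
Proof.
  intros Hc H. rewrite vscal_pmul. apply (pmul_f A d v); auto using vscal_pone_ge0.
Qed.

(** Pass through [x' y]. The two error terms [d y] and [x' d'] stay disjoint from [v] by the
    f-algebra axiom. *)
Lemma vle_on_mul v x x' y y' :
  vle vzero v -> vle vzero x' -> vle vzero y ->
  vle_on v x x' -> vle_on v y y' -> vle_on v (pmul x y) (pmul x' y').
Proof.
  intros Hv Hx Hy (d & Hd & Md & Ld) (d' & Hd' & Md' & Ld').
  apply (vle_on_trans v _ (pmul x' y)); auto.
  - exists (pmul d y). repeat split; [now apply pmul_pos | exact (proj2 (pmul_f A d v y Md Hy)) |].
    rewrite <- pmulDl. now apply pmul_ler.
  - exists (pmul x' d'). repeat split; [now apply pmul_pos | exact (proj1 (pmul_f A d' v x' Md' Hx)) |].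
    rewrite <- pmulDr. now apply pmul_lel.
Qed.

Lemma vle_on_scal v c g h : vle vzero v -> 0 <= c -> vle_on v g h ->
  vle_on v (vscal c g) (vscal c h).
Proof.
  intros Hv Hc (d & Hd & Md & Ld). exists (vscal c d).
  repeat split; [now apply vscal_ge0 | now apply vmeet_scal_eq0 |].
  rewrite <- vscalDr. now apply vle_scal.
Qed.

Lemma eprod_ge0 n (f : nat -> A) :
  (forall k, (k < n)%nat -> vle vzero (f k)) -> vle vzero (eprod n f).
Proof.
  induction n as [|n IH]; intros H; simpl; [apply pone_ge0|].
  apply pmul_pos; [apply IH; intros; apply H; lia | apply H; lia].
Qed.

Lemma eprod_vle_on v n (f g : nat -> A) :
  vle vzero v -> (forall k, (k < n)%nat -> vle vzero (f k)) ->
  (forall k, (k < n)%nat -> vle vzero (g k)) ->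
  (forall k, (k < n)%nat -> vle_on v (f k) (g k)) ->
  vle_on v (eprod n f) (eprod n g).
Proof.
  intros Hv. induction n as [|n IH]; intros Hf Hg H; simpl.
  - apply vle_on_le; auto; apply vle_refl.
  - apply vle_on_mul; auto. apply eprod_ge0; auto.
Qed.

Lemma eprod_scal_pone n (c : nat -> R) :
  eprod n (fun k => vscal (c k) (pone : A)) = vscal (rprod n c) pone.
Proof.
  induction n as [|n IH]; simpl; [now rewrite vscal1|].
  now rewrite IH, pmulZl, pmul1l, vscalA.
Qed.

Lemma eprod_vle_on_zero v n (f : nat -> A) k :
  vle vzero v -> (forall j, (j < n)%nat -> vle vzero (f j)) ->
  (k < n)%nat -> vle_on v (f k) vzero -> vle_on v (eprod n f) vzero.
Proof.
  intros Hv. induction n as [|n IH]; intros Hf Hk H; simpl; [lia|].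
  destruct (Nat.eq_dec k n) as [->|Hne].
  - rewrite <- (pmul0r (eprod n f)).
    apply vle_on_mul; auto; [apply eprod_ge0; auto | apply vle_on_le; auto; apply vle_refl].
  - rewrite <- (pmul0l (f n)).
    apply vle_on_mul; auto; [apply vle_refl| |apply vle_on_le; auto; apply vle_refl].
    apply IH; auto; lia.
Qed.

(* Order continuity: [g /\ N v] is a lower bound of [S], hence [g /\ N v <= i] for every [N]. *)
Lemma vle_on_inf v g (S : A -> Prop) i :
  vle vzero v -> vle vzero g -> (forall x, S x -> vle vzero x) -> vis_inf A S i ->
  (forall x, S x -> vle_on v g x) -> vle_on v g i.
Proof.
  intros Hv Hg HS [_ Hi] H. exists (vpos (vsub g i)).
  repeat split; [apply vpos_ge0 | | apply vpos_sub_ge].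
  set (z := vmeet _ _).
  assert (Hz : vle vzero z) by (apply vmeet_ge0; [apply vpos_ge0 | assumption]).
  apply (varchi A z g Hz). intros n. set (N := INR n).
  assert (HN : 0 <= N) by apply pos_INR.
  assert (Hlow : vle (vmeet g (vscal N v)) i).
  { apply Hi. intros x Sx. destruct (H x Sx) as (d & Hd & Md & Ld).
    rewrite <- (vaddr0 x).
    replace vzero with (vmeet d (vscal N v)).
    2: { rewrite vmeetC. apply vmeet_scal_eq0; auto. now rewrite vmeetC. }
    eapply vle_trans; [|now apply vmeet_addl_le, HS].
    apply vmeet_glb; [eapply vle_trans; [apply vmeet_l | exact Ld] | apply vmeet_r]. }
  assert (Hz1 : vle z (vpos (vsub g (vscal N v)))).
  { eapply vle_trans; [apply vmeet_l|]. apply vpos_le; [apply vpos_ge0|].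
    apply vle_subLR. rewrite vaddC.
    eapply vle_trans; [|apply vle_add, Hlow].
    apply vle_subLR, vmeet_glb; apply vle_subLR.
    - apply vle_addr, vpos_ge0.
    - apply vpos_sub_ge. }
  rewrite <- (vadd0 A g). apply vle_subLR.
  apply (vmeet_eq0_le0 (vscal N (vpos (vsub g (vscal N v)))) (vpos (vsub (vscal N v) g))).
  - apply vmeet_scal_eq0; auto using vpos_disjoint.
  - apply vle_subLR. eapply vle_trans; [apply vle_scal; eauto|]. now apply vle_addr.
  - eapply vle_trans; [|apply vpos_ge]. apply vle_add, vle_scal; auto. apply vmeet_r.
Qed.

(** * Cells on which elements are nearly scalar *)

Lemma exists_bounded_on v b :
  vle vzero v -> v <> vzero ->
  exists v' M, vle vzero v' /\ v' <> vzero /\ vle v' v /\ vle_on v' b (vscal M pone).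
Proof.
  intros Hv Hn.
  set (v1 := vmeet v pone).
  assert (Hv1 : vle vzero v1) by (apply vmeet_ge0; auto using pone_ge0).
  (* The identity is a weak order unit: if [v] is disjoint from [e], then [v = v e] is disjoint from
     [v]. *)
  assert (Hn1 : v1 <> vzero).
  { intros H. unfold v1 in H. rewrite vmeetC in H.
    destruct (pmul_f A _ _ v H Hv) as [D _]. rewrite pmul1r in D.
    apply Hn, vle_anti; auto. apply (vmeet_eq0_le0 _ _ v D); apply vle_refl. }
  (* Otherwise [n e <= b] on the support of [v1] for every [n], whence [n v1 <= b^+], and the
     Archimedean property makes [v1] zero. *)
  apply NNPP. intros Hno. apply Hn1, (varchi A v1 (vpos b) Hv1). intros n.
  destruct (vle_on_total v1 (vscal (INR n) pone) b Hv1) as [(d & Hd & Md & Ld)|(v' & H1 & H2 & H3 & H4)].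
  - rewrite <- (vaddr0 (vpos b)).
    replace vzero with (vmeet d (vscal (INR n) v1)).
    2: { rewrite vmeetC. apply vmeet_scal_eq0; [apply pos_INR|]. now rewrite vmeetC. }
    eapply vle_trans; [|apply vmeet_addl_le, vpos_ge0].
    apply vmeet_glb; [|apply vle_refl].
    eapply vle_trans; [|eapply vle_trans; [apply Ld | apply vle_add, vpos_ge]].
    apply vle_scal; [apply pos_INR | apply vmeet_r].
  - exfalso. apply Hno. exists v', (INR n). repeat split; auto.
    eapply vle_trans; [apply H3 | apply vmeet_l].
Qed.

(** Either [b] is below every [e/(n+1)] on the support of [v], hence vanishes there, or some
    [eta e <= b] on a smaller support. After shrinking again to bound [b] above, [s] is found among
    the [eta * lam ^ N]. *)
Lemma exists_cell v b lam :
  vle vzero v -> v <> vzero -> 1 < lam ->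
  vle_on v b vzero \/
  exists v' s, vle vzero v' /\ v' <> vzero /\ vle v' v /\ 0 < s /\
    vle_on v' (vscal s pone) b /\ vle_on v' b (vscal (lam * s) pone).
Proof.
  intros Hv Hn Hl.
  destruct (classic (forall n : nat, vle_on v b (vadd vzero (vscal (/ INR (S n)) pone)))) as [H|H].
  { left. exact (vle_on_archimedean v b vzero pone Hv pone_ge0 H). }
  right. apply not_all_ex_not in H. destruct H as [n H].
  set (eta := / INR (S n)) in *.
  assert (He : 0 < eta) by apply Rinv_0_lt_compat, lt_0_INR, Nat.lt_0_succ.
  destruct (vle_on_total v b (vadd vzero (vscal eta pone)) Hv) as [|(v1 & Hv1 & Hn1 & Le1 & On1)];
    [contradiction|].
  rewrite vadd0 in On1. clear H.
  destruct (exists_bounded_on v1 b Hv1 Hn1) as (v2 & M & Hv2 & Hn2 & Le2 & On2).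
  apply (vle_on_weaken v1 v2) in On1; auto.
  assert (Le : vle v2 v) by (eapply vle_trans; eauto).
  destruct (geometric_unbounded lam eta M Hl He) as [N HN].
  assert (On3 : vle_on v2 b (vscal (eta * lam ^ N) pone)).
  { eapply vle_on_trans; eauto. apply vle_on_le; auto. apply vle_scal_le; auto using pone_ge0. }
  (* Descend through the thresholds: either [b] is below the next lower one on all of [v2], and the
     search goes on, or it is above it on a nonzero part, which is the cell. At the bottom,
     [s = eta]. *)
  clear On2 HN M. induction N as [|N IH].
  - exists v2, eta. repeat split; auto. eapply vle_on_trans; eauto.
    apply vle_on_le; auto. apply vle_scal_le; auto using pone_ge0. simpl. nra.
  - destruct (vle_on_total v2 b (vscal (eta * lam ^ N) pone) Hv2) as [H|(v3 & Hv3 & Hn3 & Le3 & H)].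
    + now apply IH.
    + exists v3, (eta * lam ^ N). repeat split; auto.
      * eapply vle_trans; eauto.
      * apply Rmult_lt_0_compat; auto. apply pow_lt. lra.
      * apply (vle_on_weaken v2); auto.
        replace (lam * (eta * lam ^ N)) with (eta * lam ^ S N) by (simpl; ring). exact On3.
Qed.

(** Refine the cell for one [b k] after another; inequalities on a support persist on smaller ones.
    The ratio may depend on [k] so that Young's inequality can use [mu ^ (1 / p k)]. *)
Lemma exists_cells v n (b : nat -> A) (lam : nat -> R) :
  vle vzero v -> v <> vzero -> (forall k, (k < n)%nat -> 1 < lam k) ->
  exists v', vle vzero v' /\ v' <> vzero /\ vle v' v /\
   ((exists k, (k < n)%nat /\ vle_on v' (b k) vzero) \/
    exists s : nat -> R, forall k, (k < n)%nat ->
      0 < s k /\ vle_on v' (vscal (s k) pone) (b k) /\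
      vle_on v' (b k) (vscal (lam k * s k) pone)).
Proof.
  intros Hv Hn. induction n as [|n IH]; intros Hl.
  { exists v. repeat split; auto; [apply vle_refl|]. right. exists (fun _ => 0). intros; lia. }
  destruct IH as (v1 & Hv1 & Hn1 & Le1 & [(k & Hk & Ok)|(s & Hs)]); auto.
  { exists v1. repeat split; auto. left. exists k. split; [lia | assumption]. }
  destruct (exists_cell v1 (b n) (lam n) Hv1 Hn1) as [H|(v2 & c & Hv2 & Hn2 & Le2 & Hc & H1 & H2)];
    auto.
  { exists v1. repeat split; auto. left. exists n. split; [lia | assumption]. }
  exists v2. repeat split; auto; [eapply vle_trans; eauto|].
  right. exists (fun k => if Nat.eq_dec k n then c else s k).
  intros k Hk. destruct (Nat.eq_dec k n) as [->|Hne]; [now auto|].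
  destruct (Hs k) as (P1 & P2 & P3); [lia|].
  repeat split; auto; apply (vle_on_weaken v1); auto.
Qed.

End PhiAlgebra.

(** * Powers and geometric means *)

(** The set inside [epow]; its infimum is the geometric mean of [a] and [e] with weights [f] and
    [1 - f]. *)
Definition power_set {A : PhiAlg} (a : A) (f : R) : A -> Prop :=
  fun x => exists t1 t2, 0 < t1 /\ 0 < t2 /\
    Rpower t1 f * Rpower t2 (1 - f) = 1 /\
    x = vadd (vscal (f * t1) a) (vscal ((1 - f) * t2) pone).

(** Existence of the infima behind fractional powers, phrased without the scalar field so that the
    algebra can be treated as a real one. *)
Definition has_powers (A : PhiAlg) : Prop :=
  forall (a : A) f, vle vzero a -> 0 < f < 1 ->
    vis_inf A (power_set a f) (vInf A (power_set a f)).

Lemma power_set_ge0 {A : PhiAlg} (a : A) f x :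
  vle vzero a -> 0 < f < 1 -> power_set a f x -> vle vzero x.
Proof.
  intros Ha Hf (t1 & t2 & H1 & H2 & _ & ->).
  apply vadd_ge0; [apply vscal_ge0; auto; nra | apply vscal_pone_ge0; nra].
Qed.

Lemma frac_part_cases q : frac_part q = 0 \/ 0 < frac_part q < 1.
Proof. destruct (base_fp q). lra. Qed.

Lemma npow_ge0 {A : PhiAlg} (a : A) m : vle vzero a -> vle vzero (npow a m).
Proof. intros H. now apply eprod_ge0. Qed.

Lemma epow_ge0 {A : PhiAlg} (a : A) q : has_powers A -> vle vzero a -> vle vzero (epow a q).
Proof.
  intros HA Ha. unfold epow. fold (power_set a (frac_part q)).
  apply pmul_pos; [now apply npow_ge0|].
  destruct (Req_dec_T (frac_part q) 0) as [|Hne]; [apply pone_ge0|].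
  destruct (frac_part_cases q) as [|Hf]; [contradiction|].
  apply (HA a _ Ha Hf). intros x. now apply power_set_ge0.
Qed.

Lemma rprod_const n c : rprod n (fun _ => c) = c ^ n.
Proof. induction n as [|n IH]; simpl; [reflexivity | rewrite IH; ring]. Qed.

(** Two-term arithmetic-geometric means for [t1 * s] and [t2]. The right sides are affine majorants
    of the concave function [s ^ f]. *)
Lemma Rpower_le_tangent s f t1 t2 :
  0 < s -> 0 < f < 1 -> 0 < t1 -> 0 < t2 -> Rpower t1 f * Rpower t2 (1 - f) = 1 ->
  Rpower s f <= f * t1 * s + (1 - f) * t2.
Proof.
  intros Hs Hf H1 H2 H.
  pose proof (weighted_AMGM 2 (fun k => match k with O => t1 * s | _ => t2 end)
     (fun k => match k with O => f | _ => 1 - f end)) as AG.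
  simpl in AG. rewrite Rpower_base_mult in AG by assumption.
  assert (HP : Rpower s f = 1 * (Rpower t1 f * Rpower s f) * Rpower t2 (1 - f)).
  { transitivity (Rpower s f * (Rpower t1 f * Rpower t2 (1 - f))); [rewrite H|]; ring. }
  rewrite HP. eapply Rle_trans; [apply AG|].
  - intros [|[|k]] Hk; try lia; auto. now apply Rmult_lt_0_compat.
  - intros [|[|k]] Hk; try lia; lra.
  - ring.
  - right. ring.
Qed.

(** Mirrors the splitting in [epow]; as [q >= 0], its integer part is nonnegative and [Z.to_nat]
    loses nothing. *)
Lemma Rpower_floor s q : 0 < s -> 0 <= q ->
  Rpower s q = s ^ Z.to_nat (Int_part q) * Rpower s (frac_part q).
Proof.
  intros Hs Hq. rewrite <- Rpower_pow, <- Rpower_plus by assumption. f_equal.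
  unfold frac_part. rewrite INR_IZR_INZ, Z2Nat.id; [ring|].
  destruct (base_Int_part q) as [_ H].
  assert (H' : -1 < IZR (Int_part q)) by lra. apply lt_IZR in H'. lia.
Qed.

(** The integer part of the exponent is handled by products. For the fractional part,
    [Rpower_le_tangent] bounds every member of [power_set] from below on the support of [v], and
    [vle_on_inf] passes to the infimum. *)
Lemma epow_vle_on {A : PhiAlg} (v b : A) s q :
  has_powers A -> vle vzero v -> vle vzero b -> 0 < s -> 0 <= q ->
  vle_on v (vscal s pone) b -> vle_on v (vscal (Rpower s q) pone) (epow b q).
Proof.
  intros HA Hv Hb Hs Hq H. unfold epow. fold (power_set b (frac_part q)).
  rewrite (Rpower_floor s q Hs Hq), <- vscalA, vscal_pmul.
  assert (Hpos : forall r, 0 <= Rpower s r) by (intros; apply Rlt_le, exp_pos).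
  apply vle_on_mul; auto using npow_ge0, vscal_pone_ge0.
  { rewrite <- rprod_const, <- eprod_scal_pone. unfold npow.
    apply eprod_vle_on; auto. intros. apply vscal_pone_ge0. lra. }
  destruct (Req_dec_T (frac_part q) 0) as [->|Hne].
  { rewrite Rpower_O, vscal1 by assumption. apply vle_on_le; auto. apply vle_refl. }
  destruct (frac_part_cases q) as [|Hf]; [contradiction|].
  eapply vle_on_inf; [auto | auto using vscal_pone_ge0 | | now apply HA |].
  { intros x. now apply power_set_ge0. }
  intros x (t1 & t2 & H1 & H2 & HP & ->).
  apply (vle_on_trans v _
    (vadd (vscal (frac_part q * t1) (vscal s pone)) (vscal ((1 - frac_part q) * t2) pone))); auto.
  - rewrite vscalA, <- vscalDl. apply vle_on_le; auto.
    apply vle_scal_le; auto using pone_ge0, Rpower_le_tangent.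
  - apply vle_on_add; auto; [|apply vle_on_le; auto; apply vle_refl].
    apply vle_on_scal; auto. apply Rmult_le_pos; lra.
Qed.

Lemma Rpower_gt1 mu r : 1 < mu -> 0 < r -> 1 < Rpower mu r.
Proof. intros Hm Hr. rewrite <- (Rpower_O mu) by lra. now apply Rpower_lt. Qed.

(** On a cell the product is at most [mu * rprod n s] times [e]; [young_real] bounds [rprod n s],
    and [epow_vle_on] turns the scalars [s k ^ p k] back into powers of [x k]. *)
Lemma young_phi {A : PhiAlg} n p t (x : nat -> A) :
  has_powers A ->
  (forall k, (k < n)%nat -> 1 < p k) -> rsum n (fun k => / p k) = 1 ->
  (forall k, (k < n)%nat -> 0 < t k) ->
  rprod n (fun k => Rpower (t k) (/ p k)) = 1 ->
  (forall k, (k < n)%nat -> vle vzero (x k)) ->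
  vle (eprod n x) (vsum n (fun k => vscal (/ p k * t k) (epow (x k) (p k)))).
Proof.
  intros HA Hp H1 Ht HP Hx.
  assert (Hr : forall k, (k < n)%nat -> 0 < / p k).
  { intros k Hk. apply Rinv_0_lt_compat. specialize (Hp k Hk). lra. }
  assert (Hrt : forall k, (k < n)%nat -> 0 <= / p k * t k).
  { intros k Hk. apply Rmult_le_pos; apply Rlt_le; auto. }
  set (Y := vsum _ _).
  assert (HY : vle vzero Y).
  { apply vsum_ge0. intros k Hk. apply vscal_ge0; auto. apply epow_ge0; auto. }
  apply vle_of_forall_scal_gt1; auto. intros mu Hmu.
  assert (HmY : vle vzero (vscal mu Y)) by (apply vscal_ge0; auto; lra).
  apply vle_local_global. intros v0 Hv0 Hn0.
  (* With ratios [mu ^ (1 / p k)] the total loss in the product is exactly [mu], because the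
     exponents sum to 1. *)
  destruct (exists_cells v0 n x (fun k => Rpower mu (/ p k)) Hv0 Hn0)
    as (v & Hv & Hn & Hle & Hcase).
  { intros. apply Rpower_gt1; auto. }
  exists v. repeat split; auto. destruct Hcase as [(k & Hk & Hz)|(s & Hs)].
  { apply (vle_on_trans v _ vzero); auto using vle_on_le. now apply (eprod_vle_on_zero v n x k). }
  apply (vle_on_trans v _ (vscal (mu * rprod n s) pone)); auto.
  - replace (mu * rprod n s) with (rprod n (fun k => Rpower mu (/ p k) * s k)).
    2: { rewrite rprod_mul, rprod_Rpower_const, H1, Rpower_1 by lra. reflexivity. }
    rewrite <- eprod_scal_pone. apply eprod_vle_on; auto; [|apply Hs].
    intros k Hk. apply vscal_pone_ge0. apply Rmult_le_pos; apply Rlt_le; [apply exp_pos | now apply Hs].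
  - rewrite <- vscalA. apply vle_on_scal; auto; [lra|].
    apply (vle_on_trans v _ (vscal (rsum n (fun k => / p k * t k * Rpower (s k) (p k))) pone)); auto.
    + apply vle_on_le; auto. apply vle_scal_le; auto using pone_ge0.
      apply young_real; auto. apply Hs.
    + rewrite <- vsum_scall. apply vsum_vle_on; auto. intros k Hk.
      destruct (Hs k Hk) as (Hsk & Hlow & _). specialize (Hp k Hk).
      rewrite <- vscalA. apply vle_on_scal; auto. apply epow_vle_on; auto. lra.
Qed.

(** * Weighted geometric means against products of powers *)

Lemma rsum_single n k c :
  (k < n)%nat -> rsum n (fun j => if Nat.eq_dec j k then c else 0) = c.
Proof.
  assert (H0 : forall m, (m <= k)%nat -> rsum m (fun j => if Nat.eq_dec j k then c else 0) = 0).
  { induction m as [|m IH]; intros Hm; simpl; [reflexivity|].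
    rewrite IH by lia. destruct (Nat.eq_dec m k); [lia | ring]. }
  induction n as [|n IH]; intros Hk; simpl; [lia|].
  destruct (Nat.eq_dec n k) as [->|Hne].
  - rewrite H0 by lia. ring.
  - rewrite IH by lia. ring.
Qed.

(** The weights other than the [k]-th contribute [tau ^ (1 - r k)], which forces
    [t k = tau ^ (1 - 1 / r k)]. On a cell where [b k] vanishes, this large weight costs nothing
    while [tau] tends to 0. *)
Lemma exists_weights n r k tau :
  (k < n)%nat -> 0 < r k -> rsum n r = 1 -> 0 < tau ->
  exists t : nat -> R, (forall j, 0 < t j) /\ (forall j, j <> k -> t j = tau) /\
    rprod n (fun j => Rpower (t j) (r j)) = 1.
Proof.
  intros Hk Hr H1 Htau.
  exists (fun j => if Nat.eq_dec j k then Rpower tau (1 - / r k) else tau).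
  repeat split.
  - intros j. destruct (Nat.eq_dec j k); [apply exp_pos | assumption].
  - intros j Hj. destruct (Nat.eq_dec j k); [contradiction | reflexivity].
  - rewrite rprod_Rpower_exp. transitivity (exp 0); [f_equal | apply exp_0].
    rewrite (rsum_ext n _ (fun j => r j * ln tau + (if Nat.eq_dec j k then - ln tau else 0))).
    + rewrite rsum_add, rsum_mulr, H1, rsum_single by assumption. ring.
    + intros j _. destruct (Nat.eq_dec j k) as [->|]; [|ring].
      unfold Rpower at 1. rewrite ln_exp. field. lra.
Qed.

(** Here [u] is any lower bound of the family defining the geometric mean, the form in which Young's
    inequality supplies it. *)
Lemma geometric_mean_le_eprod {A : PhiAlg} n r (b : nat -> A) u :
  has_powers A ->
  (forall k, (k < n)%nat -> 0 < r k) -> rsum n r = 1 ->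
  (forall k, (k < n)%nat -> vle vzero (b k)) ->
  (forall t : nat -> R, (forall k, (k < n)%nat -> 0 < t k) ->
     rprod n (fun k => Rpower (t k) (r k)) = 1 ->
     vle u (vsum n (fun k => vscal (r k * t k) (b k)))) ->
  vle u (eprod n (fun k => epow (b k) (r k))).
Proof.
  intros HA Hr H1 Hb Hu.
  set (P := eprod _ _).
  assert (HP : vle vzero P).
  { apply eprod_ge0. intros. apply epow_ge0; auto. }
  apply vle_of_forall_scal_gt1; auto. intros mu Hmu.
  assert (HmP : vle vzero (vscal mu P)) by (apply vscal_ge0; auto; lra).
  apply vle_local_global. intros v0 Hv0 Hn0.
  destruct (exists_cells v0 n b (fun _ => mu) Hv0 Hn0) as (v & Hv & Hn & Hle & Hcase); auto.
  exists v. repeat split; auto. destruct Hcase as [(k & Hk & Hz)|(s & Hs)].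
  (* Some [b k] vanishes on the cell: with all other weights equal to [tau = 1/(m+1)], [u] is at
     most [tau] times a fixed element there. *)
  - apply (vle_on_trans v _ vzero); auto using vle_on_le.
    apply (vle_on_archimedean v u vzero (vsum n (fun j => vscal (r j) (b j)))); auto.
    { apply vsum_ge0. intros. apply vscal_ge0; auto. now apply Rlt_le, Hr. }
    intros m. set (tau := / INR (S m)).
    assert (Htau : 0 < tau) by apply Rinv_0_lt_compat, lt_0_INR, Nat.lt_0_succ.
    destruct (exists_weights n r k tau Hk (Hr k Hk) H1 Htau) as (t & Ht & Htj & Hprod).
    eapply vle_on_trans; [auto | apply vle_on_le, (Hu t); auto |].
    rewrite vadd0, <- vsum_scalr. apply vsum_vle_on; auto. intros j Hj.
    rewrite vscalA. specialize (Hr j Hj). destruct (Nat.eq_dec j k) as [->|Hne].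
    + apply (vle_on_trans v _ vzero); auto.
      * rewrite <- (vscal0r (r k * t k)). apply vle_on_scal; auto.
        apply Rmult_le_pos; apply Rlt_le; auto.
      * apply vle_on_le; auto. apply vscal_ge0; auto. apply Rmult_le_pos; lra.
    + rewrite Htj, Rmult_comm by assumption. apply vle_on_le; auto. apply vle_refl.
  - set (G := rprod n (fun k => Rpower (s k) (r k))).
    assert (HG : 0 < G) by (apply rprod_pos; intros; apply exp_pos).
    apply (vle_on_trans v _ (vscal (mu * G) pone)); auto.
    (* The weights [G / s k] equalise the terms: each [(G / s k) b k] is at most [mu G e] on the
       cell. Their normalisation holds because the geometric mean of the [s k] is [G]. *)
    + eapply vle_on_trans; [auto | apply vle_on_le, (Hu (fun k => G * / s k)); auto |].
      * intros k Hk. apply Rmult_lt_0_compat; auto. apply Rinv_0_lt_compat. now apply Hs.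
      * apply (Rmult_eq_reg_r G); [|lra]. unfold G at 2. rewrite <- rprod_mul, Rmult_1_l.
        rewrite (rprod_ext n _ (fun k => Rpower G (r k))).
        -- rewrite rprod_Rpower_const, H1. now apply Rpower_1.
        -- intros k Hk. destruct (Hs k Hk) as (Hsk & _).
           rewrite <- Rpower_base_mult; auto.
           ++ f_equal. field. lra.
           ++ apply Rmult_lt_0_compat; auto. now apply Rinv_0_lt_compat.
      * replace (mu * G) with (rsum n r * (mu * G)) by (rewrite H1; ring).
        rewrite <- rsum_mulr, <- vsum_scall. apply vsum_vle_on; auto.
        intros k Hk. destruct (Hs k Hk) as (Hsk & _ & Hup). specialize (Hr k Hk).
        replace (r k * (mu * G)) with (r k * (G * / s k) * (mu * s k)) by (field; lra).
        rewrite <- (vscalA A (r k * (G * / s k)) (mu * s k) pone). apply vle_on_scal; auto.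
        apply Rmult_le_pos; [lra|]. apply Rlt_le, Rmult_lt_0_compat; auto.
        now apply Rinv_0_lt_compat.
    (* Conversely [s k ^ r k] times [e] is below the power of [b k] on the cell, and these scalars
       multiply to [G]. *)
    + rewrite <- vscalA. apply vle_on_scal; auto; [lra|].
      unfold G. rewrite <- eprod_scal_pone. apply eprod_vle_on; auto.
      * intros. apply vscal_pone_ge0, Rlt_le, exp_pos.
      * intros. apply epow_ge0; auto.
      * intros k Hk. destruct (Hs k Hk) as (Hsk & Hlow & _).
        apply epow_vle_on; auto. now apply Rlt_le, Hr.
Qed.

(** * Real and complex scalars *)

Lemma vis_sup_unique (E : RVL) S (s s' : E) : vis_sup E S s -> vis_sup E S s' -> s = s'.
Proof. intros [H1 H2] [H1' H2']. now apply vle_anti; auto. Qed.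

Lemma vis_inf_ext (E : RVL) (S S' : E -> Prop) i :
  (forall x, S x <-> S' x) -> vis_inf E S i -> vis_inf E S' i.
Proof.
  intros H [H1 H2]. split.
  - intros x Hx. now apply H1, H.
  - intros u Hu. apply H2. intros x Hx. now apply Hu, H.
Qed.

(** The modulus dominates [f] and [-f], hence its own opposite. For complex scalars, [f] is the real
    part and the angles are 0 and pi. *)
Lemma Kmod_ge0 K (E : RVL) (u : Kcar K E) : Kcond K E -> vle vzero (Kmod K E u).
Proof.
  destruct K; simpl; intros HK.
  - apply vle_opp_ge0.
    apply (vle_trans E _ u); [|apply vjoin_l].
    apply (vle_add_cancel _ _ (vjoin u (vopp u))). rewrite vaddNl.
    rewrite <- (vaddN E u). apply vle_addl, vjoin_r.
  - destruct (epsilon_spec (inhabits vzero) _ (HK (fst u) (snd u))) as [Hub _].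
    match goal with |- vle _ ?s => change s with
      (epsilon (inhabits (@vzero E)) (vis_sup E (fun y => exists t, 0 <= t <= 2 * PI /\
              y = vadd (vscal (cos t) (fst u)) (vscal (sin t) (snd u))))); set (m := s) end.
    assert (H0 : vle (fst u) m).
    { apply Hub. exists 0. split; [pose proof PI_RGT_0; lra|].
      now rewrite cos_0, sin_0, vscal1, vscal0l, vaddr0. }
    assert (Hpi : vle (vopp (fst u)) m).
    { apply Hub. exists PI. split; [pose proof PI_RGT_0; lra|].
      now rewrite cos_PI, sin_PI, vscalN1, vscal0l, vaddr0. }
    apply vle_opp_ge0. apply (vle_trans E _ (fst u)); auto.
    apply (vle_add_cancel _ _ m). rewrite vaddNl, <- (vaddN E (fst u)). now apply vle_addl.
Qed.

(** In the complex case the supremum is over [cos t] times [x], and is attained at angle 0. *)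
Lemma Kmod_emb K (E : RVL) (x : E) : Kcond K E -> vle vzero x -> Kmod K E (Kemb K E x) = x.
Proof.
  destruct K; simpl; intros HK Hx.
  - apply vle_anti; [|apply vjoin_l]. apply vjoin_lub; [apply vle_refl|].
    apply (vle_trans E _ vzero); auto.
    apply (vle_add_cancel _ _ x). now rewrite vaddNl, vadd0.
  - apply (vis_sup_unique E _ _ _ (epsilon_spec (inhabits vzero) _ (HK x vzero))).
    split.
    + intros y (t & Ht & ->). rewrite vscal0r, vaddr0.
      rewrite <- (vscal1 E x) at 2. apply vle_scal_le; auto. apply COS_bound.
    + intros y Hy. apply Hy. exists 0. split; [pose proof PI_RGT_0; lra|].
      now rewrite cos_0, sin_0, vscal1, vscal0l, vaddr0.
Qed.

Lemma Kpos_emb K (E : RVL) (x : E) : Kcond K E -> vle vzero x -> Kpos K E (Kemb K E x).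
Proof. intros HK Hx. unfold Kpos. now rewrite Kmod_emb. Qed.

Lemma Kre_emb K (E : RVL) (x : E) : Kre K E (Kemb K E x) = x.
Proof. now destruct K. Qed.

Lemma Kpos_re K (E : RVL) u :
  Kcond K E -> Kpos K E u -> vle vzero (Kre K E u) /\ u = Kemb K E (Kre K E u).
Proof.
  intros HK Hu. unfold Kpos in Hu. rewrite <- Hu, Kre_emb.
  split; [now apply Kmod_ge0 | reflexivity].
Qed.

Lemma Kle_emb K (E : RVL) (x y : E) :
  Kcond K E -> vle x y -> Kle K E (Kemb K E x) (Kemb K E y).
Proof.
  intros HK H. unfold Kle.
  replace (Kadd K E _ _) with (Kemb K E (vsub y x)).
  - apply Kpos_emb; auto. now apply vsub_ge0.
  - destruct K; simpl; [reflexivity|]. now rewrite vopp0, vaddr0.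
Qed.

(** [power_set a f] is the two-term set [tri_set] for [a] and [e], both equal to their moduli. *)
Lemma has_powers_of_wgm_closed K (A : PhiAlg) : Kcond K A -> wgm_closed K A -> has_powers A.
Proof.
  intros HK HA a f Ha Hf. unfold vInf. apply epsilon_spec.
  destruct (HA 2%nat (fun k => match k with O => Kemb K A a | _ => Kemb K A pone end)
             (fun k => match k with O => f | _ => 1 - f end)) as [i Hi].
  { intros [|[|k]] Hk; lia || lra. }
  { simpl. ring. }
  exists i. eapply vis_inf_ext; [|exact Hi].
  intros x. unfold tri_set, power_set. simpl.
  rewrite !Kmod_emb by auto using pone_ge0. split.
  - intros (t & Ht & Hp & ->). exists (t O), (t 1%nat).
    repeat split; [apply Ht; lia | apply Ht; lia | lra | now rewrite vadd0].
  - intros (t1 & t2 & H1 & H2 & Hp & ->).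
    exists (fun k => match k with O => t1 | _ => t2 end). repeat split.
    + intros [|k] _; assumption.
    + lra.
    + now rewrite vadd0.
Qed.

(** * Positive linear maps between the underlying real lattices *)

Section PositiveOperator.
Context (K : Kfield) (A B : RVL) (T : Kcar K A -> Kcar K B).
Context (HA : Kcond K A) (HB : Kcond K B) (HT : Klinear K A B T) (HTp : Kpositive K A B T).

(** The real linear map induced by [T]; on the positive cone it determines [T], as [Kemb_Kreal_part]
    records. *)
Definition Kreal_part (x : A) : B := Kre K B (T (Kemb K A x)).

Lemma Kreal_part_ge0 x : vle vzero x -> vle vzero (Kreal_part x).
Proof. intros Hx. apply Kpos_re; auto using Kpos_emb. Qed.

Lemma Kemb_Kreal_part x : vle vzero x -> T (Kemb K A x) = Kemb K B (Kreal_part x).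
Proof. intros Hx. apply Kpos_re; auto using Kpos_emb. Qed.

Lemma Kreal_part_add x y : Kreal_part (vadd x y) = vadd (Kreal_part x) (Kreal_part y).
Proof.
  unfold Kreal_part.
  replace (Kemb K A (vadd x y)) with (Kadd K A (Kemb K A x) (Kemb K A y)).
  - rewrite (proj1 HT). now destruct K.
  - destruct K; simpl; [reflexivity|]. now rewrite vadd0.
Qed.

Lemma Kreal_part_scal c x : Kreal_part (vscal c x) = vscal c (Kreal_part x).
Proof.
  unfold Kreal_part.
  destruct K; simpl in *.
  - now rewrite (proj2 HT).
  - replace (vscal c x, vzero) with (Kscale KC A (c, 0) (x, vzero)).
    + rewrite (proj2 HT). simpl. now rewrite vscal0l, vsubr0.
    + simpl. now rewrite !vscal0r, vsubr0, vscal0l, vadd0.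
Qed.

Lemma Kreal_part_le x y : vle x y -> vle (Kreal_part x) (Kreal_part y).
Proof.
  intros H. rewrite <- (vsubK y x), Kreal_part_add, vaddC.
  apply vle_addr, Kreal_part_ge0. now apply vsub_ge0.
Qed.

Lemma Kreal_part_sum n f : Kreal_part (vsum n f) = vsum n (fun k => Kreal_part (f k)).
Proof.
  induction n as [|n IH]; simpl.
  - rewrite <- (vscal0l vzero), Kreal_part_scal. apply vscal0l.
  - now rewrite Kreal_part_add, IH.
Qed.

End PositiveOperator.

(** Common source of both inequalities: the image of the product is a lower bound of the family
    defining the geometric mean of the images of the powers. *)
Lemma Kreal_part_young K n p (A : PhiAlg) (B : RVL) T (x : nat -> A) t :
  has_powers A -> Kcond K A -> Kcond K B -> Klinear K A B T -> Kpositive K A B T ->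
  (forall k, (k < n)%nat -> 1 < p k) -> rsum n (fun k => / p k) = 1 ->
  (forall k, (k < n)%nat -> vle vzero (x k)) ->
  (forall k, (k < n)%nat -> 0 < t k) -> rprod n (fun k => Rpower (t k) (/ p k)) = 1 ->
  vle (Kreal_part K A B T (eprod n x))
    (vsum n (fun k => vscal (/ p k * t k) (Kreal_part K A B T (epow (x k) (p k))))).
Proof.
  intros HP HA HB HT HTp Hp H1 Hx Ht Hprod.
  eapply vle_trans; [apply Kreal_part_le; auto; apply (young_phi n p t); auto|].
  rewrite Kreal_part_sum by assumption.
  apply vsum_le. intros k _. rewrite Kreal_part_scal by assumption. apply vle_refl.
Qed.

(** * Hölder's inequality for positive maps *)

Theorem theorem4p7 :
  forall (K : Kfield) (n : nat) (p : nat -> R),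
  (forall k, (k < n)%nat -> 1 < p k) ->
  rsum n (fun k => / p k) = 1 ->
  forall A : PhiAlg, Kcond K A -> wgm_closed K A ->
  (* (1) *)
  (forall B : PhiAlg, Kcond K B -> wgm_closed K B ->
   forall T : Kcar K A -> Kcar K B, Klinear K A B T -> Kpositive K A B T ->
   forall a : nat -> Kcar K A,
     Kle K B
       (T (Kemb K A (eprod n (fun k => Kmod K A (a k)))))
       (Kemb K B (eprod n (fun k =>
          epow (Kre K B (T (Kemb K A (epow (Kmod K A (a k)) (p k))))) (/ p k)))))
  /\
  (* (2) *)
  (forall B : RVL, Kcond K B -> wgm_closed K B ->
   forall T : Kcar K A -> Kcar K B, Klinear K A B T -> Kpositive K A B T ->
   forall a : nat -> Kcar K A,
     Kle K B
       (T (Kemb K A (eprod n (fun k => Kmod K A (a k)))))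
       (Kemb K B (tri K B n (fun k => T (Kemb K A (epow (Kmod K A (a k)) (p k))))
                            (fun k => / p k)))).
Proof.
  intros K n p Hp H1 A HA WA.
  assert (PA : has_powers A) by now apply (has_powers_of_wgm_closed K).
  assert (Hr : forall k, (k < n)%nat -> 0 < / p k < 1).
  { intros k Hk. specialize (Hp k Hk). split; [apply Rinv_0_lt_compat; lra|].
    rewrite <- Rinv_1. apply Rinv_lt_contravar; lra. }
  assert (Hx : forall (a : nat -> Kcar K A) k, vle vzero (Kmod K A (a k)))
    by (intros; now apply Kmod_ge0).
  (* The image of the positive product is an embedded real element, so both claims reduce to
     inequalities in the real lattice [B]. *)
  split; intros B HB WB T HT HTp a;
    rewrite (Kemb_Kreal_part K A B T) by (auto; now apply eprod_ge0);
    apply Kle_emb; auto.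
  - apply geometric_mean_le_eprod; auto.
    + now apply (has_powers_of_wgm_closed K).
    + intros. now apply Hr.
    + intros k _. apply Kreal_part_ge0; auto. now apply epow_ge0.
    + intros t Ht Hprod. now apply Kreal_part_young.
  (* Closedness of [B] makes [tri] a true infimum, so it suffices to bound every member of its set
     from below. *)
  - apply (epsilon_spec (inhabits vzero) _
      (WB n (fun k => T (Kemb K A (epow (Kmod K A (a k)) (p k)))) _ Hr H1)).
    intros y (t & Ht & Hprod & ->).
    eapply vle_trans; [apply (Kreal_part_young K n p A B T _ t); auto|].
    apply vsum_le. intros k _.
    assert (Hk : vle vzero (epow (Kmod K A (a k)) (p k))) by now apply epow_ge0.
    (* The image of a power is positive, so the modulus in [tri_set] leaves it unchanged. *)
    rewrite (Kemb_Kreal_part K A B T), Kmod_emb by auto using Kreal_part_ge0.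
    apply vle_refl.
Qed.
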